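(* If the surface energy $\gamma\in C^3([-\pi,\pi])$ satisfies $$\int_{-\pi}^{\pi}\frac{\gamma(\theta)}{2\pi}\,d\theta\ \ge\ \frac52\,\big\|\gamma^{(3)}\big\|_{L^2},$$ then $$2\gamma(\theta)-\gamma(\theta)\cos(\theta-\phi)-\gamma'(\theta)\sin(\theta-\phi)\ge\gamma(\phi),\qquad\forall\,\theta,\phi\in[-\pi,\pi],$$ and thus the ES-PFEM is unconditionally energy stable: for any $\tau>0$, if $(\mathbf X^{m+1},\mu^{m+1})\in\mathbb X_p^h\times\mathbb K_p^h$, $m\ge0$, satisfy for every $m\ge0$ $$\Big(\frac{\mathbf X^{m+1}-\mathbf X^m}{\tau},\varphi^h\mathbf n^m\Big)^h_{\Gamma^m}+\big(\partial_s\mu^{m+1},\partial_s\varphi^h\big)^h_{\Gamma^m}=0\quad\forall\varphi^h\in\mathbb K_p^h,$$ $$\big(\mu^{m+1},\mathbf n^m\cdot\boldsymbol\omega^h\big)^h_{\Gamma^m}-\big(G(\theta^m)\partial_s\mathbf X^{m+1},\partial_s\boldsymbol\omega^h\big)^h_{\Gamma^m}=0\quad\forall\boldsymbol\omega^h\in\mathbb X_p^h,$$ starting from a given $\mathbf X^0\in\mathbb X_p^h$, then $W_c^m:=\sum_{j=1}^N|\mathbf h_j^m|\,\gamma(\theta_j^m)$ satisfies $W_c^{m+1}\le W_c^m\le\dots\le W_c^0$ for all $m\ge0$.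
   Context: The surface energy $\gamma$ is positive and $2\pi$-periodic; for $\gamma\in C^3([-\pi,\pi])$ this means $\gamma^{(i)}(-\pi)=\gamma^{(i)}(\pi)$ for $i=0,1,2$. The norm is $\|f\|_{L^2}=\big(\int_{-\pi}^{\pi}|f(\theta)|^2d\theta\big)^{1/2}$. $G(\theta)=\begin{pmatrix}\gamma(\theta)&-\gamma'(\theta)\\ \gamma'(\theta)&\gamma(\theta)\end{pmatrix}$. For $\mathbf v=(v_1,v_2)^T$, $\mathbf v^\perp=(v_2,-v_1)^T$. Let $N\ge3$ be an integer, $h=1/N$, $\rho_j=jh$ ($0\le j\le N$), $I_j=[\rho_{j-1},\rho_j]$. $\mathbb K_p^h$ is the space of continuous functions $u^h$ on $[0,1]$ which are affine on each $I_j$ and satisfy $u^h(0)=u^h(1)$; $\mathbb X_p^h=\mathbb K_p^h\times\mathbb K_p^h$. For each $m$, $\mathbf h_j^m=(h^m_{j,x},h^m_{j,y})^T=\mathbf X^m(\rho_j)-\mathbf X^m(\rho_{j-1})$, assumed nonzero for all $j$ and $m$ (so that the following are defined): the normal $\mathbf n^m$ is constant on $I_j$ with value $-(\mathbf h_j^m)^\perp/|\mathbf h_j^m|$, and $\theta^m|_{I_j}=\theta_j^m\in[-\pi,\pi]$ satisfies $\cos\theta_j^m=h^m_{j,x}/|\mathbf h_j^m|$, $\sin\theta_j^m=h^m_{j,y}/|\mathbf h_j^m|$. On $\Gamma^m$, for $f$ affine on each $I_j$ (including $f=\mathbf X^{m+1}$), $\partial_s f|_{I_j}=\big(f(\rho_j)-f(\rho_{j-1})\big)/|\mathbf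 h_j^m|$. The mass-lumped inner product is $(u,v)^h_{\Gamma^m}=\frac12\sum_{j=1}^N|\mathbf h_j^m|\big[(u\cdot v)(\rho_j^-)+(u\cdot v)(\rho_{j-1}^+)\big]$, with one-sided limits at the nodes. *)

(* Defs.v *)
From Stdlib Require Import Reals.
From Coquelicot Require Import Coquelicot.
Open Scope R_scope.

(** * Surface energy *)

Definition cI (a b x : R) : Prop := a <= x <= b.

(* [f] is C^3 on the closed interval [a, b], with successive derivatives
   [f1], [f2], [f3].  [D_in] and [continue_in] are relative to [cI a b], hence
   one-sided at [a] and [b]; values outside [a, b] play no role. *)
Definition is_C3_on (a b : R) (f f1 f2 f3 : R -> R) : Prop :=
  (forall x, cI a b x -> D_in f f1 (cI a b) x) /\
  (forall x, cI a b x -> D_in f1 f2 (cI a b) x) /\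
  (forall x, cI a b x -> D_in f2 f3 (cI a b) x) /\
  (forall x, cI a b x -> continue_in f3 (cI a b) x).

Definition L2norm (f : R -> R) : R :=
  sqrt (RInt (fun t => (Rabs (f t)) ^ 2) (- PI) PI).

Definition Gmul (gamma gamma1 : R -> R) (t : R) (v : R * R) : R * R :=
  (gamma t * fst v - gamma1 t * snd v, gamma1 t * fst v + gamma t * snd v).

Definition perp (v : R * R) : R * R := (snd v, - fst v).

Definition dot (u v : R * R) : R := fst u * fst v + snd u * snd v.

(** * Finite element spaces on the uniform partition of [0, 1] *)

Definition rho (N j : nat) : R := INR j * (1 / INR N).

(* The elements are I_j = [rho N (pred j), rho N j] for 1 <= j <= N. *)
Definition is_Kp (N : nat) (u : R -> R) : Prop :=
  (forall x, cI 0 1 x -> continue_in u (cI 0 1) x) /\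
  (forall j, (1 <= j <= N)%nat -> exists a b : R,
     forall x, cI (rho N (pred j)) (rho N j) x -> u x = a + b * x) /\
  u 0 = u 1.

Definition is_Xp (N : nat) (f : R -> R * R) : Prop :=
  is_Kp N (fun r => fst (f r)) /\ is_Kp N (fun r => snd (f r)).

(* The function on [0, 1] with constant value [a j] on I_j.  At the node
   between I_j and I_(j+1) it takes the value [a (j+1)]; this convention is
   immaterial since such functions are only used through one-sided limits. *)
Definition piecewise {V : Type} (N : nat) (a : nat -> V) (r : R) : V :=
  a (Nat.min N (Z.to_nat (up (INR N * r)))).

Definition lim_left (f : R -> R) (x : R) : R :=
  iota (fun l : R => filterlim f (at_left x) (locally l)).

Definition lim_right (f : R -> R) (x : R) : R :=
  iota (fun l : R => filterlim f (at_right x) (locally l)).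

(** * Geometry of the polygonal curve parametrized by [X] *)

Definition hseg (N : nat) (X : R -> R * R) (j : nat) : R * R :=
  minus (X (rho N j)) (X (rho N (pred j))).

(* [norm] on [R * R] is the Euclidean norm ([prod_norm]). *)
Definition hlen (N : nat) (X : R -> R * R) (j : nat) : R := norm (hseg N X j).

Definition normal (N : nat) (X : R -> R * R) : R -> R * R :=
  piecewise N (fun j => opp (scal (/ hlen N X j) (perp (hseg N X j)))).

(* Both values are allowed when the angle is PI modulo 2 PI. *)
Definition is_angle (N : nat) (X : R -> R * R) (j : nat) (t : R) : Prop :=
  cI (- PI) PI t /\
  cos t = fst (hseg N X j) / hlen N X j /\
  sin t = snd (hseg N X j) / hlen N X j.

Definition ds {V : NormedModule R_AbsRing} (N : nat) (X : R -> R * R)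
    (f : R -> V) : R -> V :=
  piecewise N (fun j =>
    scal (/ hlen N X j) (minus (f (rho N j)) (f (rho N (pred j))))).

Definition lumped (N : nat) (X : R -> R * R) (w : R -> R) : R :=
  1 / 2 * sum_n_m (fun j => hlen N X j *
    (lim_left w (rho N j) + lim_right w (rho N (pred j)))) 1 N.

Definition ip (N : nat) (X : R -> R * R) (u v : R -> R) : R :=
  lumped N X (fun r => u r * v r).

Definition ipv (N : nat) (X : R -> R * R) (u v : R -> R * R) : R :=
  lumped N X (fun r => dot (u r) (v r)).

(** * The ES-PFEM *)

(* One time step from [X] (with angles [theta j] on I_j) to [X'], [mu']. *)
Definition ES_PFEM_step (gamma gamma1 : R -> R) (N : nat) (tau : R)
    (X : R -> R * R) (theta : nat -> R)
    (X' : R -> R * R) (mu' : R -> R) : Prop :=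
  (forall phi : R -> R, is_Kp N phi ->
     ipv N X (fun r => scal (/ tau) (minus (X' r) (X r)))
             (fun r => scal (phi r) (normal N X r))
     + ip N X (ds N X mu') (ds N X phi) = 0) /\
  (forall omega : R -> R * R, is_Xp N omega ->
     ip N X mu' (fun r => dot (normal N X r) (omega r))
     - ipv N X (fun r => Gmul gamma gamma1 (piecewise N theta r) (ds N X X' r))
               (ds N X omega) = 0).

Definition Wc (gamma : R -> R) (N : nat) (X : R -> R * R) (theta : nat -> R)
    : R :=
  sum_n_m (fun j => hlen N X j * gamma (theta j)) 1 N.

(* Main.v *)
Require Import Defs.
From Stdlib Require Import Reals Lra Lia ZArith FunctionalExtensionality.
From Coquelicot Require Import Coquelicot.
Open Scope R_scope.

(** Two independent facts are combined.

    The inequality on [gamma].  Fix [theta] and let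
    D(t) = 2 gamma(theta) - gamma(theta) cos(theta - t)
           - gamma'(theta) sin(theta - t) - gamma(t).
    Then D and D' vanish at [theta] and
    D + D'' = 2 gamma(theta) - (gamma + gamma'')(t), so by variation of
    constants D(phi) is the integral of (D + D'')(t) sin(phi - t) from [theta]
    to [phi].  By periodicity the integration may go round the circle the
    shorter way, where the sine has a constant sign; hence D >= 0 as soon as
    gamma(s) + gamma''(s) <= 2 gamma(theta) for all s
    ([anisotropy_of_convexity_bound]).  That condition is where the largeness
    of the mean c of [gamma] enters: gamma - c and gamma'' + gamma - c are the
    convolutions of gamma''' with explicit cubic kernels, and Cauchy-Schwarz
    ([kernel_bound]) bounds them by 0.73 and 1 times the L^2 norm of gamma'''.
    Since 1 + 2 * 0.73 < 5/2, [convexity_bound] follows.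

    The energy decay.  Testing the first equation with tau mu' and the second
    with X' - X makes the two coupling terms coincide, so the stiffness form
    (G(theta) ds X', ds (X' - X)) equals minus tau times the squared norm of
    ds mu' ([stiffness_nonpos]).  On one element, with lengths L, L' and angles
    theta, theta', the stiffness form is
    gamma(theta) L'^2 / L
      - L' (gamma(theta) cos(theta - theta') + gamma'(theta) sin(theta - theta')),
    and L'^2 / L >= 2 L' - L together with the inequality on [gamma] shows
    that it is at least L' gamma(theta') - L gamma(theta)
    ([element_energy]).  Summing over the elements bounds the increment of the
    energy by the stiffness form, which is nonpositive. *)

(** * Periodic functions of class C^3 *)

Lemma nondecreasing_of_derive (f df : R -> R) (a b : R) :
  a <= b ->
  (forall x, continuity_pt f x) ->
  (forall x, a < x < b -> is_derive f x (df x)) ->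
  (forall x, a <= x <= b -> 0 <= df x) ->
  f a <= f b.
Proof.
  intros ab cf df_f df_pos.
  destruct (MVT_gen f a b df) as [c [c_in Hc]]; rewrite ?Rmin_left, ?Rmax_right in *; auto.
  specialize (df_pos c c_in). nra.
Qed.

(** A function on the circle, cut open at [PI].  Continuity on the whole line,
    rather than on the closed interval, spares a separate treatment of one-sided
    limits at the cut. *)
Record periodic_C3 (f f1 f2 f3 : R -> R) : Prop := {
  pC3_cont : forall x, continuity_pt f x;
  pC3_cont1 : forall x, continuity_pt f1 x;
  pC3_cont2 : forall x, continuity_pt f2 x;
  pC3_cont3 : forall x, continuity_pt f3 x;
  pC3_derive : forall x, - PI < x < PI -> is_derive f x (f1 x);
  pC3_derive1 : forall x, - PI < x < PI -> is_derive f1 x (f2 x);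
  pC3_derive2 : forall x, - PI < x < PI -> is_derive f2 x (f3 x);
  pC3_per : f (- PI) = f PI;
  pC3_per1 : f1 (- PI) = f1 PI;
  pC3_per2 : f2 (- PI) = f2 PI }.

Definition clamp (x : R) : R := Rmax (- PI) (Rmin PI x).

Lemma clamp_in x : - PI <= clamp x <= PI.
Proof.
  pose proof PI_RGT_0. unfold clamp, Rmax, Rmin.
  repeat destruct Rle_dec; lra.
Qed.

Lemma clamp_id x : - PI <= x <= PI -> clamp x = x.
Proof.
  intros; unfold clamp, Rmax, Rmin; repeat destruct Rle_dec; lra.
Qed.

Lemma clamp_contraction x y : Rabs (clamp y - clamp x) <= Rabs (y - x).
Proof.
  pose proof PI_RGT_0. unfold clamp, Rmax, Rmin, Rabs.
  repeat destruct Rle_dec; repeat destruct Rcase_abs; lra.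
Qed.

Lemma continuity_clamp (f : R -> R) :
  (forall x, cI (- PI) PI x -> continue_in f (cI (- PI) PI) x) ->
  forall x, continuity_pt (fun y => f (clamp y)) x.
Proof.
  intros cf x eps eps_pos.
  destruct (cf (clamp x) (clamp_in x) eps eps_pos) as [alp [alp_pos Halp]].
  exists alp; split; [exact alp_pos|]. intros y [_ y_near]. simpl in *.
  unfold Rdist in *.
  destruct (Req_dec (clamp x) (clamp y)) as [e|ne].
  - rewrite e, Rminus_diag, Rabs_R0. exact eps_pos.
  - apply Halp. split; [split; [apply clamp_in|exact ne]|].
    eapply Rle_lt_trans; [apply clamp_contraction|exact y_near].
Qed.

Lemma derive_clamp (f df : R -> R) (x : R) :
  D_in f df (cI (- PI) PI) x -> - PI < x < PI ->
  is_derive (fun y => f (clamp y)) x (df (clamp x)).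
Proof.
  intros Hd x_in.
  rewrite (clamp_id x) by lra.
  apply (is_derive_ext_loc f).
  { apply (locally_interval _ x (- PI) PI); simpl; try tauto.
    intros y ? ?. rewrite clamp_id; [reflexivity|lra]. }
  apply is_derive_Reals. intros eps eps_pos.
  destruct (Hd eps eps_pos) as [alp [alp_pos Halp]].
  assert (dpos : 0 < Rmin alp (Rmin (x + PI) (PI - x))).
  { repeat apply Rmin_glb_lt; lra. }
  exists (mkposreal _ dpos). simpl. intros h h0 h_small.
  pose proof (Rmin_l alp (Rmin (x + PI) (PI - x))).
  pose proof (Rmin_r alp (Rmin (x + PI) (PI - x))).
  pose proof (Rmin_l (x + PI) (PI - x)).
  pose proof (Rmin_r (x + PI) (PI - x)).
  pose proof (Rle_abs h). pose proof (Rle_abs (- h)) as Hn. rewrite Rabs_Ropp in Hn.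
  specialize (Halp (x + h)). simpl in Halp. unfold Rdist in Halp.
  replace (x + h - x) with h in Halp by ring.
  apply Halp. split; [|lra]. unfold D_x, cI. repeat split; lra.
Qed.

(** One-sided regularity on the closed interval becomes ordinary continuity on
    the line after composition with the retraction onto the interval. *)
Lemma periodic_C3_clamp (f f1 f2 f3 : R -> R) :
  is_C3_on (- PI) PI f f1 f2 f3 ->
  f (- PI) = f PI -> f1 (- PI) = f1 PI -> f2 (- PI) = f2 PI ->
  periodic_C3 (fun x => f (clamp x)) (fun x => f1 (clamp x))
    (fun x => f2 (clamp x)) (fun x => f3 (clamp x)).
Proof.
  intros (d0 & d1 & d2 & c3) e0 e1 e2. pose proof PI_RGT_0.
  constructor;
    try (rewrite !clamp_id by lra; assumption);
    try (apply continuity_clamp; auto; intros x Hx; eapply cont_deriv; eauto);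
    intros x Hx; apply derive_clamp; auto;
    [apply d0|apply d1|apply d2]; unfold cI; lra.
Qed.

Lemma is_derive_primitive (g : R -> R) (a x : R) :
  (forall y, continuity_pt g y) -> is_derive (RInt g a) x (g x).
Proof.
  intros cg.
  assert (cg' : forall y, continuous g y) by (intro; now apply continuity_pt_filterlim).
  apply is_derive_RInt with a; auto.
  apply filter_forall. intro y. apply RInt_correct.
  apply ex_RInt_continuous. auto.
Qed.

Lemma is_derive_continuity_pt (g : R -> R) (x l : R) :
  is_derive g x l -> continuity_pt g x.
Proof.
  intro Hg. apply continuity_pt_filterlim, (ex_derive_continuous g). now exists l.
Qed.

(** * Bounds by the L^2 norm of the third derivative *)

(** The primitive vanishing at 0 of the square of the kernel [a * s + b * s ^ 3]. *)
Definition kernel_sqr_primitive (a b s : R) : R :=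
  a ^ 2 * s ^ 3 / 3 + 2 * a * b * s ^ 5 / 5 + b ^ 2 * s ^ 7 / 7.

(** The boundary terms of three integrations by parts of the third derivative
    of [f] against the kernel K(s) = [a * s + b * s ^ 3]: they are
    K f'' - K' f' + K'' f, with derivative K f''' + 6 b f when [s] moves
    along with [x]. *)
Definition boundary_terms (f f1 f2 : R -> R) (a b s x : R) : R :=
  (a * s + b * s ^ 3) * f2 x - (a + 3 * b * s ^ 2) * f1 x + 6 * b * s * f x.

Lemma continuity_pt_sqr (g : R -> R) (x : R) :
  continuity_pt g x -> continuity_pt (fun t => g t ^ 2) x.
Proof.
  intro Hg. apply (continuity_pt_ext (mult_fct g g)).
  { intro; unfold mult_fct; ring. }
  now apply continuity_pt_mult.
Qed.

(** F is a primitive of the square of f''' - l K(x - d), so it increases.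
    Working with the primitive replaces every manipulation of integrals. *)
Lemma square_piece (f f1 f2 f3 : R -> R) (a b l d p q : R) :
  periodic_C3 f f1 f2 f3 ->
  - PI <= p -> p <= q -> q <= PI ->
  let F x := RInt (fun t => f3 t ^ 2) (- PI) x + 12 * b * l * RInt f (- PI) x
     - 2 * l * boundary_terms f f1 f2 a b (x - d) x
     + l ^ 2 * kernel_sqr_primitive a b (x - d) in
  F p <= F q.
Proof.
  intros Hf Hp pq Hq.
  set (energy := RInt (fun t => f3 t ^ 2) (- PI) : R -> R).
  set (primitive := RInt f (- PI) : R -> R).
  intro F.
  assert (dE : forall x, is_derive energy x (f3 x ^ 2)).
  { intro x. apply (is_derive_primitive (fun t => f3 t ^ 2)).
    intro. apply continuity_pt_sqr, (pC3_cont3 _ _ _ _ Hf). }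
  assert (dP : forall x, is_derive primitive x (f x)).
  { intro x. apply is_derive_primitive, (pC3_cont _ _ _ _ Hf). }
  assert (cE : forall x, continuity_pt energy x).
  { intro x; eapply is_derive_continuity_pt; apply dE. }
  assert (cP : forall x, continuity_pt primitive x).
  { intro x; eapply is_derive_continuity_pt; apply dP. }
  apply nondecreasing_of_derive with
    (df := fun x => (f3 x - l * (a * (x - d) + b * (x - d) ^ 3)) ^ 2); auto.
  - pose proof (pC3_cont _ _ _ _ Hf) as c0.
    pose proof (pC3_cont1 _ _ _ _ Hf) as c1.
    pose proof (pC3_cont2 _ _ _ _ Hf) as c2.
    fold (continuity energy) (continuity primitive) (continuity f)
      (continuity f1) (continuity f2) in *.
    clear Hf dE dP.
    change (continuity F). unfold F, boundary_terms, kernel_sqr_primitive.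
    clearbody energy primitive. clear F.
    reg.
  - intros x Hx.
    assert (d0 : is_derive f x (f1 x)) by (apply (pC3_derive _ _ _ _ Hf); lra).
    assert (d1 : is_derive f1 x (f2 x)) by (apply (pC3_derive1 _ _ _ _ Hf); lra).
    assert (d2 : is_derive f2 x (f3 x)) by (apply (pC3_derive2 _ _ _ _ Hf); lra).
    specialize (dE x). specialize (dP x).
    unfold F, boundary_terms, kernel_sqr_primitive. clearbody energy primitive.
    auto_derive.
    + repeat split; try (eexists; eassumption).
    + apply is_derive_unique in d0, d1, d2, dE, dP.
      change (fun t => f t) with f. change (fun t => f1 t) with f1.
      change (fun t => f2 t) with f2.
      change (fun t => energy t) with energy.
      change (fun t => primitive t) with primitive.
      rewrite d0, d1, d2, dE, dP. field.
  - intros. apply pow2_ge_0.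
Qed.

(** Let K(s) = [a * s + b * s ^ 3], extended 2 PI-periodically.  Integrating
    by parts, the convolution of K with f''' at [p] is made of the jumps of K
    and K'' at PI, which multiply f''(p) and f(p), and of the constant K'''
    against the mean of f; Cauchy-Schwarz then gives the bound.  Cauchy-Schwarz
    is obtained from the nonnegativity of the integral of (f''' - l K)^2 for a
    well chosen [l]; the jump of K at [p] splits this integral into two
    applications of [square_piece]. *)
Lemma kernel_bound (f f1 f2 f3 : R -> R) (a b q p : R) :
  periodic_C3 f f1 f2 f3 ->
  0 < q -> 2 * kernel_sqr_primitive a b PI <= q ->
  - PI <= p <= PI ->
  (2 * PI * ((a + b * PI ^ 2) * f2 p
             + 6 * b * (f p - RInt f (- PI) PI / (2 * PI)))) ^ 2
    <= q * RInt (fun t => f3 t ^ 2) (- PI) PI.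
Proof.
  intros Hf q0 Hq Hp. pose proof PI_RGT_0 as pi0.
  set (mean := RInt f (- PI) PI / (2 * PI)).
  set (I := 2 * PI * _). set (M2 := RInt _ _ _ : R).
  assert (quad : forall l, 0 <= M2 - 2 * l * I + l ^ 2 * q).
  { intro l.
    pose proof (square_piece f f1 f2 f3 a b l (p - PI) (- PI) p Hf) as L.
    pose proof (square_piece f f1 f2 f3 a b l (p + PI) p PI Hf) as Rr.
    cbv beta zeta in L, Rr.
    assert (e0 : RInt (fun t => f3 t ^ 2) (- PI) (- PI) = 0)
      by (apply (RInt_point (V := R_CompleteNormedModule))).
    assert (p0 : RInt f (- PI) (- PI) = 0)
      by (apply (RInt_point (V := R_CompleteNormedModule))).
    assert (pM : RInt f (- PI) PI = 2 * PI * mean).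
    { assert (e : forall r, r = 2 * PI * (r / (2 * PI))) by (intro; field; lra).
      apply e. }
    rewrite e0, p0 in L. rewrite pM in Rr. fold M2 in Rr.
    specialize (L ltac:(lra) ltac:(lra) ltac:(lra)).
    specialize (Rr ltac:(lra) ltac:(lra) ltac:(lra)).
    pose proof (Rmult_le_compat_l (l ^ 2) _ _ (pow2_ge_0 l) Hq) as lq.
    apply Rle_trans with (M2 - 2 * l * I + l ^ 2 * (2 * kernel_sqr_primitive a b PI)); [|lra].
    unfold boundary_terms in L, Rr.
    rewrite (pC3_per _ _ _ _ Hf), (pC3_per1 _ _ _ _ Hf), (pC3_per2 _ _ _ _ Hf) in L.
    unfold I, kernel_sqr_primitive in *. clear lq Hq. nra. }
  (* the minimizer of the quadratic polynomial *)
  specialize (quad (I / q)).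
  replace (M2 - 2 * (I / q) * I + (I / q) ^ 2 * q) with (M2 - I ^ 2 / q) in quad
    by (field; lra).
  replace (I ^ 2) with (q * (I ^ 2 / q)) by (field; lra).
  apply Rmult_le_compat_l; lra.
Qed.

(** The Leibniz series of arctan 1 truncated after its third term; the trivial
    bound [PI <= 4] would be too weak for [deviation_bounds]. *)
Lemma PI_le_52_15 : PI <= 52 / 15.
Proof.
  destruct (PI_ineq 1) as [_ H].
  unfold tg_alt, PI_tg in H. simpl in H. lra.
Qed.

Lemma le_of_sqr_le (x q M : R) :
  0 <= q -> 0 <= M -> x ^ 2 <= q ^ 2 * M -> Rabs x <= q * sqrt M.
Proof.
  intros q0 M0 H.
  rewrite <- (sqrt_Rsqr q) by lra. rewrite <- sqrt_mult by (unfold Rsqr; nra).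
  rewrite <- sqrt_Rsqr_abs. apply sqrt_le_1_alt. unfold Rsqr. nra.
Qed.

(** The kernels whose jumps isolate f - c and f'' + f - c; the squares of their
    L^2 norms are PI^5 / 945 and PI / 6 - PI^3 / 45 + PI^5 / 945. *)
Lemma deviation_bounds (f f1 f2 f3 : R -> R) (x : R) :
  periodic_C3 f f1 f2 f3 -> - PI <= x <= PI ->
  let mean := RInt f (- PI) PI / (2 * PI) in
  let norm3 := sqrt (RInt (fun t => f3 t ^ 2) (- PI) PI) in
  Rabs (f x - mean) <= 73 / 100 * norm3 /\
  Rabs (f2 x + (f x - mean)) <= 1 * norm3.
Proof.
  intros Hf Hx mean norm3.
  pose proof PI_RGT_0 as pi0. pose proof PI2_3_2 as pi3. pose proof PI_le_52_15 as pi4.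
  assert (pi_3 : 3 ^ 3 <= PI ^ 3) by (apply pow_incr; lra).
  assert (pi_5 : PI ^ 5 <= (52 / 15) ^ 5) by (apply pow_incr; lra).
  assert (M0 : 0 <= RInt (fun t => f3 t ^ 2) (- PI) PI).
  { apply RInt_ge_0; [lra| |intros; apply pow2_ge_0].
    apply (ex_RInt_continuous (V := R_CompleteNormedModule)). intros z _. apply continuity_pt_filterlim.
    apply continuity_pt_sqr, (pC3_cont3 _ _ _ _ Hf). }
  (* [b] is such that f(p) - mean gets coefficient 1; [a] is such that f''(p)
     gets coefficient 0, respectively 1 *)
  pose proof (kernel_bound _ _ _ _ (- PI / 12) (1 / (12 * PI)) ((73 / 100) ^ 2) x Hf)
    as Bf.
  pose proof (kernel_bound _ _ _ _ (1 / (2 * PI) - PI / 12) (1 / (12 * PI)) (1 ^ 2) x Hf)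
    as Bf2.
  replace (2 * kernel_sqr_primitive (- PI / 12) (1 / (12 * PI)) PI) with (PI ^ 5 / 945) in Bf
    by (unfold kernel_sqr_primitive; field; lra).
  replace (2 * kernel_sqr_primitive (1 / (2 * PI) - PI / 12) (1 / (12 * PI)) PI)
    with (PI / 6 - PI ^ 3 / 45 + PI ^ 5 / 945) in Bf2
    by (unfold kernel_sqr_primitive; field; lra).
  fold mean in Bf, Bf2.
  replace (2 * PI * _) with (f x - mean) in Bf by (field; lra).
  replace (2 * PI * _) with (f2 x + (f x - mean)) in Bf2 by (field; lra).
  split; (apply le_of_sqr_le; [lra|exact M0|]).
  - apply Bf; lra.
  - apply Bf2; lra.
Qed.

(** With c the mean and M the norm of f''', the left side is at most c + M and
    the right side at least 2 c - 2 * 0.73 M. *)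
Lemma convexity_bound (f f1 f2 f3 : R -> R) (s t : R) :
  periodic_C3 f f1 f2 f3 ->
  RInt f (- PI) PI / (2 * PI) >= 5 / 2 * sqrt (RInt (fun t => f3 t ^ 2) (- PI) PI) ->
  - PI <= s <= PI -> - PI <= t <= PI ->
  f s + f2 s <= 2 * f t.
Proof.
  intros Hf large Hs Ht.
  destruct (deviation_bounds _ _ _ _ s Hf Hs) as [_ Ds].
  destruct (deviation_bounds _ _ _ _ t Hf Ht) as [Dt _].
  apply Rabs_le_between in Ds, Dt.
  pose proof (sqrt_pos (RInt (fun t => f3 t ^ 2) (- PI) PI)).
  lra.
Qed.

(** * From the convexity bound to the inequality on the surface energy *)

(** Let D be the difference of the two sides of the conclusion as a function of
    [phi].  The function E(t) = D'(t) sin(phi - t) + D(t) cos(phi - t) satisfies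
    E' = (D + D'') sin(phi - t), E(theta) = 0 and E(phi) = D(phi), and it is
    2 PI-periodic.  Following E from [theta] to [phi] along the shorter arc,
    possibly through the cut at PI, E moves in one direction only. *)
Lemma anisotropy_of_convexity_bound (f f1 f2 f3 : R -> R) (theta phi : R) :
  periodic_C3 f f1 f2 f3 ->
  (forall s, - PI <= s <= PI -> f s + f2 s <= 2 * f theta) ->
  - PI <= theta <= PI -> - PI <= phi <= PI ->
  f phi <= 2 * f theta - f theta * cos (theta - phi) - f1 theta * sin (theta - phi).
Proof.
  intros Hf conv Ht Hp. pose proof PI_RGT_0 as pi0.
  set (D := fun t => 2 * f theta - f theta * cos (theta - t)
                     - f1 theta * sin (theta - t) - f t).
  set (D1 := fun t => - f theta * sin (theta - t) + f1 theta * cos (theta - t) - f1 t).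
  set (E := fun t => D1 t * sin (phi - t) + D t * cos (phi - t)).
  assert (E_theta : E theta = 0).
  { unfold E, D, D1. rewrite Rminus_diag, cos_0, sin_0. ring. }
  assert (E_phi : E phi = D phi).
  { unfold E. rewrite Rminus_diag, cos_0, sin_0. ring. }
  assert (E_per : E (- PI) = E PI).
  { unfold E, D, D1.
    rewrite (pC3_per _ _ _ _ Hf), (pC3_per1 _ _ _ _ Hf).
    replace (theta - - PI) with (theta - PI + 2 * PI) by ring.
    replace (phi - - PI) with (phi - PI + 2 * PI) by ring.
    rewrite !cos_plus, !sin_plus, cos_2PI, sin_2PI. ring. }
  assert (E_cont : forall x, continuity_pt E x).
  { pose proof (pC3_cont _ _ _ _ Hf) as c0.
    pose proof (pC3_cont1 _ _ _ _ Hf) as c1.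
    fold (continuity f) (continuity f1) in *. clear Hf.
    change (continuity E). unfold E, D, D1. clear E_per E_phi E_theta E D D1. reg. }
  assert (E_derive : forall x, - PI < x < PI ->
            is_derive E x ((2 * f theta - (f x + f2 x)) * sin (phi - x))).
  { intros x Hx.
    pose proof (pC3_derive _ _ _ _ Hf x Hx) as d0.
    pose proof (pC3_derive1 _ _ _ _ Hf x Hx) as d1.
    unfold E, D, D1. auto_derive.
    - repeat split; try (eexists; eassumption).
    - change (fun t => f t) with f. change (fun t => f1 t) with f1.
      rewrite (is_derive_unique _ _ _ d0), (is_derive_unique _ _ _ d1). unfold Rminus. ring. }
  assert (up : forall a b, - PI <= a -> a <= b -> b <= PI ->
            (forall x, a <= x <= b -> 0 <= sin (phi - x)) -> E a <= E b).
  { intros a b Ha ab Hb sn.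
    apply nondecreasing_of_derive with
      (df := fun x => (2 * f theta - (f x + f2 x)) * sin (phi - x)); auto.
    - intros. apply E_derive. lra.
    - intros x Hx. specialize (conv x ltac:(lra)). specialize (sn x Hx).
      apply Rmult_le_pos; lra. }
  assert (down : forall a b, - PI <= a -> a <= b -> b <= PI ->
            (forall x, a <= x <= b -> sin (phi - x) <= 0) -> E b <= E a).
  { intros a b Ha ab Hb sn.
    apply Ropp_le_cancel.
    apply nondecreasing_of_derive with (f := fun x => - E x)
      (df := fun x => - ((2 * f theta - (f x + f2 x)) * sin (phi - x))); auto.
    - intro x. now apply (continuity_pt_opp E).
    - intros. apply (is_derive_opp E). apply E_derive. lra.
    - intros x Hx. specialize (conv x ltac:(lra)). specialize (sn x Hx).
      nra. }
  assert (goal : 0 <= E phi); [|unfold D in E_phi; lra].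
  rewrite <- E_theta.
  destruct (Rle_lt_dec theta phi) as [tp|pt].
  - destruct (Rle_lt_dec (phi - theta) PI) as [near|far].
    + apply up; try lra. intros. apply sin_ge_0; lra.
    (* the shorter arc runs backwards from [theta] through the cut *)
    + apply Rle_trans with (E (- PI)).
      * apply down; try lra. intros. apply sin_le_0; lra.
      * rewrite E_per. apply down; try lra. intros x Hx.
        rewrite <- (Ropp_involutive (phi - x)), sin_neg.
        pose proof (sin_ge_0 (- (phi - x))). lra.
  - destruct (Rle_lt_dec (theta - phi) PI) as [near|far].
    + apply down; try lra. intros x Hx.
      rewrite <- (Ropp_involutive (phi - x)), sin_neg.
      pose proof (sin_ge_0 (- (phi - x))). lra.
    (* the shorter arc runs forwards from [theta] through the cut *)
    + apply Rle_trans with (E PI).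
      * apply up; try lra. intros x Hx.
        rewrite <- (Ropp_involutive (phi - x)), sin_neg.
        pose proof (sin_le_0 (- (phi - x))). lra.
      * rewrite <- E_per. apply up; try lra. intros. apply sin_ge_0; lra.
Qed.

Lemma anisotropy_inequality
  (gamma gamma1 gamma2 gamma3 : R -> R)
  (gamma_C3 : is_C3_on (- PI) PI gamma gamma1 gamma2 gamma3)
  (gamma_per : gamma (- PI) = gamma PI)
  (gamma1_per : gamma1 (- PI) = gamma1 PI)
  (gamma2_per : gamma2 (- PI) = gamma2 PI)
  (gamma_large :
     RInt (fun t => gamma t / (2 * PI)) (- PI) PI >= 5 / 2 * L2norm gamma3)
  (theta phi : R) :
  - PI <= theta <= PI -> - PI <= phi <= PI ->
  gamma phi <= 2 * gamma theta - gamma theta * cos (theta - phi)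
                - gamma1 theta * sin (theta - phi).
Proof.
  intros Ht Hp. pose proof PI_RGT_0 as pi0.
  pose proof (periodic_C3_clamp _ _ _ _ gamma_C3 gamma_per gamma1_per gamma2_per) as Hc.
  pose proof (anisotropy_of_convexity_bound _ _ _ _ theta phi Hc) as S. cbv beta in S.
  rewrite !clamp_id in S by assumption.
  apply S; try assumption. intros s Hs.
  rewrite <- (clamp_id theta) by assumption.
  eapply (convexity_bound _ _ _ _ s theta Hc); try assumption.
  replace (RInt (fun x => gamma (clamp x)) (- PI) PI / (2 * PI))
    with (RInt (fun t => gamma t / (2 * PI)) (- PI) PI).
  - unfold L2norm in gamma_large.
    erewrite (RInt_ext (fun t => gamma3 (clamp t) ^ 2)); [exact gamma_large|].
    intros x. rewrite Rmin_left, Rmax_right by lra. intro Hx.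
    cbv beta. rewrite clamp_id by lra. symmetry; apply pow2_abs.
  - unfold Rdiv at 2. rewrite (Rmult_comm _ (/ (2 * PI))).
    rewrite <- (RInt_scal (V := R_CompleteNormedModule)).
    + apply RInt_ext. intros x. rewrite Rmin_left, Rmax_right by lra. intro Hx.
      rewrite clamp_id by lra. unfold scal; simpl; unfold mult; simpl. field. lra.
    + apply (ex_RInt_continuous (V := R_CompleteNormedModule)). intros z _. apply continuity_pt_filterlim.
      apply (pC3_cont _ _ _ _ Hc).
Qed.

(** * Evaluation of the mass-lumped products *)

(** The lumped product sees its arguments through one-sided limits at the nodes,
    hence through their values on the open elements. *)
Definition on_elements {V : Type} (N : nat) (w : R -> V) (c : nat -> V) : Prop :=
  forall j r, (1 <= j <= N)%nat -> rho N (pred j) < r < rho N j -> w r = c j.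

Lemma rho_lt (N j : nat) : (1 <= j <= N)%nat -> rho N (pred j) < rho N j.
Proof.
  intros Hj. unfold rho. destruct j as [|j]; [lia|].
  rewrite Nat.pred_succ, S_INR.
  assert (0 < INR N) by (apply lt_0_INR; lia).
  assert (0 < 1 / INR N) by (apply Rdiv_lt_0_compat; lra).
  nra.
Qed.

Lemma piecewise_on_elements {V : Type} (N : nat) (a : nat -> V) :
  on_elements N (piecewise N a) a.
Proof.
  intros j r Hj [Hl Hr]. unfold piecewise.
  assert (N0 : 0 < INR N) by (apply lt_0_INR; lia).
  assert (e : forall k, rho N k * INR N = INR k) by (intro; unfold rho; field; lra).
  apply (Rmult_lt_compat_r (INR N)) in Hl, Hr; try assumption.
  rewrite e in Hl, Hr.
  replace (up (INR N * r)) with (Z.of_nat j).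
  - rewrite Nat2Z.id, Nat.min_r by lia. reflexivity.
  - destruct j as [|j]; [lia|]. rewrite Nat.pred_succ in Hl.
    rewrite S_INR in Hr.
    apply tech_up; rewrite <- INR_IZR_INZ, S_INR; lra.
Qed.

Lemma lim_left_const (w : R -> R) (a x c : R) :
  a < x -> (forall r, a < r < x -> w r = c) -> lim_left w x = c.
Proof.
  intros ax Hw. unfold lim_left.
  apply (iota_filterlim_locally (V := R_CompleteNormedModule)
           (F := at_left x) w c).
  apply filterlim_ext_loc with (fun _ => c); [|apply filterlim_const].
  unfold at_left, within.
  apply (locally_interval _ x a p_infty); simpl; auto.
  intros r Hr _ rx. symmetry. auto.
Qed.

Lemma lim_right_const (w : R -> R) (x b c : R) :
  x < b -> (forall r, x < r < b -> w r = c) -> lim_right w x = c.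
Proof.
  intros xb Hw. unfold lim_right.
  apply (iota_filterlim_locally (V := R_CompleteNormedModule)
           (F := at_right x) w c).
  apply filterlim_ext_loc with (fun _ => c); [|apply filterlim_const].
  unfold at_right, within.
  apply (locally_interval _ x m_infty b); simpl; auto.
  intros r _ Hr rx. symmetry. auto.
Qed.

Lemma lumped_on_elements (N : nat) (X : R -> R * R) (w : R -> R) (c : nat -> R) :
  on_elements N w c ->
  lumped N X w = sum_n_m (fun j => hlen N X j * c j) 1 N.
Proof.
  intros Hw. unfold lumped.
  rewrite <- (sum_n_m_mult_l (K := R_Ring)).
  apply sum_n_m_ext_loc. intros j Hj.
  pose proof (rho_lt N j Hj).
  rewrite (lim_left_const w (rho N (pred j)) (rho N j) (c j)); auto.
  rewrite (lim_right_const w (rho N (pred j)) (rho N j) (c j)); auto.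
  unfold mult; simpl. field.
Qed.

Lemma sum_le_loc (u v : nat -> R) (N : nat) :
  (forall j, (1 <= j <= N)%nat -> u j <= v j) ->
  sum_n_m u 1 N <= sum_n_m v 1 N.
Proof.
  induction N as [|N IH]; intros H.
  - rewrite !sum_n_m_zero by lia. apply Rle_refl.
  - rewrite !sum_n_Sm by lia. apply Rplus_le_compat; [apply IH|]; intros; apply H; lia.
Qed.

(** * The finite element spaces are vector spaces *)

Lemma continue_in_linear (f g : R -> R) (D : R -> Prop) (k l x : R) :
  continue_in f D x -> continue_in g D x ->
  continue_in (fun r => k * f r + l * g r) D x.
Proof.
  intros Hf Hg.
  apply limit_plus; apply (limit_mul (fun _ => _)); auto;
  intros eps He; exists 1; split; try lra; intros; simpl; unfold Rdist;
  rewrite Rminus_diag, Rabs_R0; lra.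
Qed.

Lemma is_Kp_linear (N : nat) (u v : R -> R) (k l : R) :
  is_Kp N u -> is_Kp N v -> is_Kp N (fun r => k * u r + l * v r).
Proof.
  intros (cu & au & pu) (cv & av & pv). repeat split.
  - intros x Hx. apply continue_in_linear; auto.
  - intros j Hj. destruct (au j Hj) as (a & b & Hu). destruct (av j Hj) as (a' & b' & Hv).
    exists (k * a + l * a'), (k * b + l * b'). intros x Hx.
    rewrite Hu, Hv by assumption. ring.
  - now rewrite pu, pv.
Qed.

Lemma is_Kp_ext (N : nat) (u v : R -> R) :
  (forall r, u r = v r) -> is_Kp N u -> is_Kp N v.
Proof.
  intros e (cu & au & pu). repeat split.
  - intros x Hx eps He. destruct (cu x Hx eps He) as (al & al0 & H).
    exists al. split; auto. intros y Hy. rewrite <- !e. auto.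
  - intros j Hj. destruct (au j Hj) as (a & b & Hu). exists a, b. intros.
    rewrite <- e. auto.
  - now rewrite <- !e.
Qed.

Lemma is_Kp_scal (N : nat) (u : R -> R) (k : R) :
  is_Kp N u -> is_Kp N (fun r => k * u r).
Proof.
  intros Hu. apply is_Kp_ext with (fun r => k * u r + 0 * u r); [intro; ring|].
  now apply is_Kp_linear.
Qed.

Lemma is_Xp_minus (N : nat) (X Y : R -> R * R) :
  is_Xp N X -> is_Xp N Y -> is_Xp N (fun r => minus (X r) (Y r)).
Proof.
  intros [X1 X2] [Y1 Y2]. split.
  - apply is_Kp_ext with (fun r => 1 * fst (X r) + (-1) * fst (Y r)).
    + intro r. unfold minus, plus, opp; simpl. unfold plus, opp; simpl. ring.
    + now apply is_Kp_linear.
  - apply is_Kp_ext with (fun r => 1 * snd (X r) + (-1) * snd (Y r)).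
    + intro r. unfold minus, plus, opp; simpl. unfold plus, opp; simpl. ring.
    + now apply is_Kp_linear.
Qed.

(** * Energy decay *)

Lemma lumped_ext (N : nat) (X : R -> R * R) (w w' : R -> R) :
  (forall r, w r = w' r) -> lumped N X w = lumped N X w'.
Proof.
  intro e. now replace w' with w by (apply functional_extensionality; exact e).
Qed.

(** The test function tau mu', rather than mu', turns the coupling term of the
    first equation into that of the second one pointwise, so that its lumped
    product never has to be evaluated. *)
Lemma stiffness_nonpos (gamma gamma1 : R -> R) (N : nat) (tau : R)
    (X : R -> R * R) (theta : nat -> R) (X' : R -> R * R) (mu' : R -> R) :
  0 < tau -> is_Xp N X -> is_Xp N X' -> is_Kp N mu' ->
  ES_PFEM_step gamma gamma1 N tau X theta X' mu' ->
  ipv N X (fun r => Gmul gamma gamma1 (piecewise N theta r) (ds N X X' r))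
      (ds N X (fun r => minus (X' r) (X r))) <= 0.
Proof.
  intros tau0 HX HX' Hmu [e1 e2].
  specialize (e1 _ (is_Kp_scal N mu' tau Hmu)).
  specialize (e2 _ (is_Xp_minus N X' X HX' HX)).
  apply Rminus_diag_uniq in e2. rewrite <- e2.
  replace (ip N X mu' _) with
    (ipv N X (fun r => scal (/ tau) (minus (X' r) (X r)))
             (fun r => scal (tau * mu' r) (normal N X r))).
  2: { apply lumped_ext. intro r. unfold dot, scal; simpl. unfold scal, mult; simpl.
       unfold mult; simpl. field. lra. }
  enough (0 <= ip N X (ds N X mu') (ds N X (fun r => tau * mu' r))) by lra.
  unfold ip.
  rewrite (lumped_on_elements N X _ (fun j => tau *
     (/ hlen N X j * (mu' (rho N j) - mu' (rho N (pred j)))) ^ 2)).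
  - apply Rle_trans with (sum_n_m (fun _ => 0) 1 N).
    + rewrite sum_n_m_const. lra.
    + apply sum_le_loc. intros j _.
      apply Rmult_le_pos; [apply norm_ge_0|].
      apply Rmult_le_pos; [lra|apply pow2_ge_0].
  - intros j r Hj Hr. unfold ds.
    rewrite !(piecewise_on_elements N _ j r Hj Hr).
    unfold scal, minus, plus, opp; simpl. unfold mult; simpl. ring.
Qed.

Lemma norm_pos (v : R * R) : v <> (0, 0) -> 0 < norm v.
Proof.
  intro nz. destruct v as [a b].
  assert (s : 0 < a ^ 2 + b ^ 2).
  { destruct (Req_dec a 0) as [->|]; [destruct (Req_dec b 0) as [->|]|]; [now elim nz| |];
      nra. }
  assert (e : norm (a, b) = sqrt (a ^ 2 + b ^ 2)).
  { unfold norm; simpl. unfold prod_norm; simpl. unfold norm; simpl. unfold abs; simpl.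
    f_equal. rewrite <- (Rmult_assoc _ (Rabs a)), <- (Rmult_assoc _ (Rabs b)).
    rewrite !Rmult_1_r. rewrite <- !Rabs_mult, !Rabs_pos_eq by nra. reflexivity. }
  rewrite e. now apply sqrt_lt_R0.
Qed.

Lemma minus_minus_exchange (u v u' v' : R * R) :
  minus (minus u v) (minus u' v') = minus (minus u u') (minus v v').
Proof.
  destruct u, v, u', v'. unfold minus, plus, opp; simpl.
  unfold prod_plus, prod_opp, plus, opp; simpl.
  apply f_equal2; ring.
Qed.

(** The lower bound L'^2 / L >= 2 L' - L is what produces the factor 2 in front
    of [g] in the hypothesis. *)
Lemma element_energy (g g1 gphi L L' theta phi : R) :
  0 < L -> 0 < L' -> 0 <= g ->
  gphi <= 2 * g - g * cos (theta - phi) - g1 * sin (theta - phi) ->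
  L' * gphi - L * g <=
    L' ^ 2 / L * g - L' * (g * cos (theta - phi) + g1 * sin (theta - phi)).
Proof.
  intros L0 L'0 g0 H.
  assert (young : 2 * L' - L <= L' ^ 2 / L).
  { apply Rmult_le_reg_r with L; [assumption|].
    replace (L' ^ 2 / L * L) with (L' ^ 2) by (field; lra).
    pose proof (pow2_ge_0 (L' - L)). nra. }
  apply (Rmult_le_compat_l L') in H; [|lra].
  apply (Rmult_le_compat_r g) in young; lra.
Qed.

Lemma Wc_decrease (gamma gamma1 : R -> R) (N : nat) (tau : R)
    (X : R -> R * R) (theta : nat -> R) (X' : R -> R * R) (theta' : nat -> R)
    (mu' : R -> R) :
  (forall t, - PI <= t <= PI -> 0 < gamma t) ->
  (forall t p, - PI <= t <= PI -> - PI <= p <= PI ->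
     gamma p <= 2 * gamma t - gamma t * cos (t - p) - gamma1 t * sin (t - p)) ->
  0 < tau -> is_Xp N X -> is_Xp N X' -> is_Kp N mu' ->
  (forall j, (1 <= j <= N)%nat -> hseg N X j <> (0, 0)) ->
  (forall j, (1 <= j <= N)%nat -> hseg N X' j <> (0, 0)) ->
  (forall j, (1 <= j <= N)%nat -> is_angle N X j (theta j)) ->
  (forall j, (1 <= j <= N)%nat -> is_angle N X' j (theta' j)) ->
  ES_PFEM_step gamma gamma1 N tau X theta X' mu' ->
  Wc gamma N X' theta' <= Wc gamma N X theta.
Proof.
  intros pos ineq tau0 HX HX' Hmu nz nz' ang ang' step.
  pose proof (stiffness_nonpos _ _ _ _ _ _ _ _ tau0 HX HX' Hmu step) as H.
  unfold ipv in H.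
  rewrite (lumped_on_elements N X _ (fun j =>
     dot (Gmul gamma gamma1 (theta j) (scal (/ hlen N X j) (hseg N X' j)))
         (scal (/ hlen N X j) (minus (hseg N X' j) (hseg N X j))))) in H.
  2: { intros j r Hj Hr. unfold ds.
       rewrite !(piecewise_on_elements N _ j r Hj Hr). f_equal. f_equal.
       apply minus_minus_exchange. }
  enough (Wc gamma N X' theta' <=
    Wc gamma N X theta + sum_n_m (fun j => hlen N X j *
     dot (Gmul gamma gamma1 (theta j) (scal (/ hlen N X j) (hseg N X' j)))
         (scal (/ hlen N X j) (minus (hseg N X' j) (hseg N X j)))) 1 N) by lra.
  unfold Wc.
  rewrite <- (sum_n_m_plus (G := R_AbelianMonoid)).
  apply sum_le_loc. intros j Hj.
  pose proof (norm_pos _ (nz j Hj)) as L0.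
  pose proof (norm_pos _ (nz' j Hj)) as L'0.
  fold (hlen N X j) in L0. fold (hlen N X' j) in L'0.
  destruct (ang j Hj) as (t_in & c & s). destruct (ang' j Hj) as (t'_in & c' & s').
  specialize (ineq _ _ t_in t'_in).
  pose proof (element_energy _ _ _ _ _ _ _ L0 L'0 (Rlt_le _ _ (pos _ t_in)) ineq) as E.
  assert (hx : fst (hseg N X j) = hlen N X j * cos (theta j)) by (rewrite c; field; lra).
  assert (hy : snd (hseg N X j) = hlen N X j * sin (theta j)) by (rewrite s; field; lra).
  assert (hx' : fst (hseg N X' j) = hlen N X' j * cos (theta' j))
    by (rewrite c'; field; lra).
  assert (hy' : snd (hseg N X' j) = hlen N X' j * sin (theta' j))
    by (rewrite s'; field; lra).
  clear c s c' s'.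
  destruct (hseg N X j) as [a b]. destruct (hseg N X' j) as [a' b'].
  simpl in hx, hy, hx', hy'. subst a b a' b'.
  set (L := hlen N X j) in *. set (L' := hlen N X' j) in *.
  set (t := theta j) in *. set (t' := theta' j) in *.
  (* in polar coordinates the stiffness form is the right side of [E] *)
  apply Rle_trans with (L * gamma t + (L' ^ 2 / L * gamma t
     - L' * (gamma t * cos (t - t') + gamma1 t * sin (t - t')))); [lra|].
  unfold Gmul, dot, scal, minus, plus, opp; simpl.
  unfold prod_plus, prod_opp, scal, plus, opp; simpl. unfold mult; simpl.
  rewrite cos_minus, sin_minus.
  apply Req_le.
  assert (cs : sin t' ^ 2 = 1 - cos t' ^ 2).
  { pose proof (sin2_cos2 t') as q. rewrite !Rsqr_pow2 in q. lra. }
  set (st := sin t) in *. set (ct := cos t) in *. set (sp := sin t') in *. set (cp := cos t') in *.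
  transitivity (L * gamma t + (L' ^ 2 / L * gamma t * (sp ^ 2 + cp ^ 2)
     - L' * (gamma t * (ct * cp + st * sp) + gamma1 t * (st * cp - ct * sp)))).
  - rewrite cs. field. lra.
  - field. lra.
Qed.

Theorem theorem4p4
  (gamma gamma1 gamma2 gamma3 : R -> R)
  (gamma_C3 : is_C3_on (- PI) PI gamma gamma1 gamma2 gamma3)
  (gamma_per : gamma (- PI) = gamma PI)
  (gamma1_per : gamma1 (- PI) = gamma1 PI)
  (gamma2_per : gamma2 (- PI) = gamma2 PI)
  (gamma_pos : forall t : R, - PI <= t <= PI -> 0 < gamma t)
  (gamma_large :
     RInt (fun t => gamma t / (2 * PI)) (- PI) PI >= 5 / 2 * L2norm gamma3) :
  (forall theta phi : R, - PI <= theta <= PI -> - PI <= phi <= PI ->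
     2 * gamma theta - gamma theta * cos (theta - phi)
       - gamma1 theta * sin (theta - phi) >= gamma phi)
  /\
  (forall (N : nat) (tau : R)
     (X : nat -> R -> R * R) (mu : nat -> R -> R) (theta : nat -> nat -> R),
     (3 <= N)%nat ->
     0 < tau ->
     is_Xp N (X 0%nat) ->
     (forall m : nat, is_Xp N (X (S m)) /\ is_Kp N (mu (S m))) ->
     (forall m j : nat, (1 <= j <= N)%nat -> hseg N (X m) j <> (0, 0)) ->
     (forall m j : nat, (1 <= j <= N)%nat -> is_angle N (X m) j (theta m j)) ->
     (forall m : nat, ES_PFEM_step gamma gamma1 N tau
        (X m) (theta m) (X (S m)) (mu (S m))) ->
     forall m k : nat, (k <= m)%nat ->
       Wc gamma N (X (S k)) (theta (S k)) <= Wc gamma N (X k) (theta k)).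
Proof.
  assert (ineq := anisotropy_inequality gamma gamma1 gamma2 gamma3
    gamma_C3 gamma_per gamma1_per gamma2_per gamma_large).
  split.
  - intros theta phi Ht Hp. apply Rle_ge. now apply ineq.
  - intros N tau X mu theta _ tau_pos X0 X_mu nz ang step m k _.
    assert (HX : is_Xp N (X k)) by (destruct k; [exact X0|apply X_mu]).
    destruct (X_mu k) as [HX' Hmu].
    now apply (Wc_decrease gamma gamma1 N tau (X k) (theta k) (X (S k))
      (theta (S k)) (mu (S k))); auto.
Qed.
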